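(* Let $M\ge 1$ and let $D\ge 1$ be finite. Let $|\vec{0}\rangle\in\mathbb{C}^D$ be an arbitrary state vector. Let $U(\boldsymbol{\theta})$, $\boldsymbol{\theta}=(\theta_1,\dots,\theta_M)$, be a quantum circuit on $\mathbb{C}^D$ consisting of an arbitrary finite number of fixed gates and of $M$ parameterized gates $U_j(\theta_j)=\exp\!\big(-i(\theta_j+c_j)H_j\big)$, $j\in\{1,\dots,M\}$, where each $H_j$ is Hermitian and each $c_j$ is a real constant. Let $O$ be an observable and define $f:[0,2\pi]^M\to\mathbb{R}$ by $$f(\boldsymbol{\theta})=\langle\vec{0}|U^\dagger(\boldsymbol{\theta})\,O\,U(\boldsymbol{\theta})|\vec{0}\rangle .$$ Then, for any observable $O$ and any set of Hermitian operators $\{H_j \mid j\in\{1,\dots,M\}\}$, the function $f$ is $L$-Lipschitz with $$L=\sqrt{M}\,\Big[\max_{j\in\{1,\dots,M\}}\ \sup_{\boldsymbol{\theta}\in[0,2\pi]^M}\Big|\frac{\partial f(\boldsymbol{\theta})}{\partial\theta_j}\Big|\Big].$$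
   Context: A state vector is a unit vector in $\mathbb{C}^D$; an observable is a Hermitian operator on $\mathbb{C}^D$. A fixed gate is a unitary operator on $\mathbb{C}^D$ that does not depend on $\boldsymbol{\theta}$. A quantum circuit consisting of given gates is the product, in some fixed order, of these gates regarded as unitary operators on $\mathbb{C}^D$; here each of the $M$ parameterized gates $U_j(\theta_j)$ occurs exactly once in the product, interspersed with the fixed gates, and the $H_j$ are regarded as operators on $\mathbb{C}^D$. A function $f:S\to\mathbb{R}$ with $S\subset\mathbb{R}^M$ is $L$-Lipschitz if $|f(\boldsymbol{x})-f(\boldsymbol{y})|\le L\,\|\boldsymbol{x}-\boldsymbol{y}\|_2$ for all $\boldsymbol{x},\boldsymbol{y}\in S$, where $\|\cdot\|_2$ is the Euclidean norm. The partial derivatives are those of the formula for $f$, which makes sense for all $\boldsymbol{\theta}\in\mathbb{R}^M$. *)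

(* Defs.v *)
From HB Require Import structures.
From mathcomp Require Import all_boot all_order all_algebra.
From mathcomp Require Import complex.
From mathcomp Require Import all_classical all_reals all_analysis.

Set Implicit Arguments.
Unset Strict Implicit.
Unset Printing Implicit Defensive.

Import Order.TTheory GRing.Theory Num.Theory.
Import numFieldNormedType.Exports.

Local Open Scope classical_set_scope.
Local Open Scope complex_scope.
Local Open Scope sesquilinear_scope.
Local Open Scope ring_scope.

(* R[i] with the topology of its modulus; 'M[R[i]]_D thereby becomes a normed
   space, in which the exponential series below converges. *)
#[export, non_forgetful_inheritance]
HB.instance Definition _ (R : rcfType) := NormedModule.copy R[i] R[i]^o.

Section Circuit.
Variables (R : realType) (M D : nat).
Implicit Types (A O : 'M[R[i]]_D) (psi : 'cV[R[i]]_D) (theta : 'rV[R]_M).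

Definition expm A : 'M[R[i]]_D :=
  limn (series (fun k : nat => (k`!%:R)^-1 *: A ^+ k)).

Definition state_vector psi : Prop := (psi^t* *m psi) 0 0 = 1.

Inductive gate : Type :=
  | FixedGate of 'M[R[i]]_D
  | ParamGate of 'I_M.

Definition is_param (j : 'I_M) (g : gate) : bool :=
  if g is ParamGate k then k == j else false.

(* A circuit is the list of its gates, written in the order of the product:
   the last gate of the list acts first on the state. *)
Definition is_circuit (gs : seq gate) : Prop :=
  all (fun g => if g is FixedGate V then V \is unitarymx else true) gs /\
  forall j : 'I_M, count (is_param j) gs = 1%N.

Variables (H : 'I_M -> 'M[R[i]]_D) (c : 'I_M -> R).

Definition gate_op theta (g : gate) : 'M[R[i]]_D :=
  match g with
  | FixedGate V => V
  | ParamGate j => expm ((- 'i%C * (theta 0 j + c j)%:C) *: H j)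
  end.

Definition circuit_op (gs : seq gate) theta : 'M[R[i]]_D :=
  \prod_(g <- gs) gate_op theta g.

Definition expval (gs : seq gate) O psi theta : R[i] :=
  let U := circuit_op gs theta in (psi^t* *m U^t* *m O *m U *m psi) 0 0.

(* Taking the real part loses nothing when O is Hermitian: see expvalE. *)
Definition cost (gs : seq gate) O psi theta : R :=
  complex.Re (expval gs O psi theta).

Lemma expvalE (gs : seq gate) O psi theta :
  O \is hermsymmx -> expval gs O psi theta = (cost gs O psi theta)%:C.
Proof.
move=> /is_hermitianmxP; rewrite expr0 scale1r => OE.
rewrite /cost /expval; set U := circuit_op gs theta; set B := _ *m psi.
have tJK m n (X : 'M[R[i]]_(m, n)) : X^t*^t* = X.
  by apply/matrixP => a b; rewrite !mxE conjCK.
have tJM m n p (X : 'M[R[i]]_(m, n)) (Y : 'M[R[i]]_(n, p)) :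
    (X *m Y)^t* = Y^t* *m X^t* by rewrite trmx_mul map_mxM.
have BE : B^t* = B by rewrite /B !tJM !tJK -OE !mulmxA.
have /eqP : (B 0 0)^* = B 0 0 by rewrite -[in RHS]BE !mxE.
by rewrite -CrealE => /RRe_real <-.
Qed.

End Circuit.

Section Lipschitz.
Variables (R : realType) (M : nat).
Implicit Types (x y : 'rV[R]_M) (f : 'rV[R]_M -> R).

(* The library norm on 'rV[R]_M, hence its k.-lipschitz_A f, is the sup norm. *)
Definition l2norm x : R := Num.sqrt (\sum_(j < M) x 0 j ^+ 2).

Definition l2_lipschitz_on (S : set 'rV[R]_M) (L : R) f : Prop :=
  forall x y, S x -> S y -> `|f x - f y| <= L * l2norm (x - y).

Definition cube : set 'rV[R]_M :=
  [set x | forall j : 'I_M, 0 <= x 0 j <= 2 * pi].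

Definition partial f (j : 'I_M) x : R := 'D_(delta_mx 0 j) f x.

Definition sup_partial f (j : 'I_M) : R :=
  sup [set `|partial f j x| | x in cube].

(* The sup_partial f j are nonnegative, so starting the maximum at 0 is
   harmless for M >= 1. *)
Definition lipschitz_bound f : R :=
  Num.sqrt M%:R * \big[Num.max/0]_(j < M) sup_partial f j.

End Lipschitz.

Arguments FixedGate {R M D}.
Arguments ParamGate {R M D}.

(* Main.v *)
(* Move from x to y along the edges of a box, one coordinate at a time: the path
   stays in the cube, so the mean value theorem on each edge gives
   |f x - f y| <= max_j sup |d_j f| * |x - y|_1, and Cauchy-Schwarz compares the
   l1 and l2 norms.  This only uses the partial derivatives of f, but the real
   supremum of an unbounded set is a junk value, so they must be shown bounded.
   Diagonalizing H = P^-1 diag(s) P with P unitary and s real,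
   exp(-i t H) = P^-1 diag(cos(s t) - i sin(s t)) P; hence f is a polynomial in
   cosines and sines of affine functions of single coordinates. *)
From HB Require Import structures.
Require Import Defs.
From mathcomp Require Import all_boot all_order all_algebra.
From mathcomp Require Import complex.
From mathcomp Require Import all_classical all_reals all_analysis.
From mathcomp Require Import ring lra.

Set Implicit Arguments.
Unset Strict Implicit.
Unset Printing Implicit Defensive.

Import Order.TTheory GRing.Theory Num.Theory.
Import numFieldNormedType.Exports.

Local Open Scope classical_set_scope.
Local Open Scope complex_scope.
Local Open Scope sesquilinear_scope.
Local Open Scope ring_scope.

(** * Functions with bounded derivative along a fixed direction *)

Section Tame.
Variables (R : realType) (V : normedModType R) (e : V).
Implicit Types (f g : V -> R) (B C : R).

(** The bound on [f] itself is there for the product rule, where each factor multiplies the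
    derivative of the other. *)
Definition tame f := exists df B,
  forall x, [/\ is_derive x e f (df x), `|f x| <= B & `|df x| <= B].

Lemma tame_cst (a : R) : tame (fun=> a).
Proof.
exists (fun=> 0), `|a| => x; split; rewrite ?normr0//.
exact: is_derive_cst.
Qed.

Lemma tameD f g : tame f -> tame g -> tame (fun x => f x + g x).
Proof.
move=> [df [B fB]] [dg [C gC]]; exists (df + dg), (B + C) => x.
have [f1 f2 f3] := fB x; have [g1 g2 g3] := gC x; split.
- exact: is_deriveD.
- by rewrite (le_trans (ler_normD _ _))// lerD.
- by rewrite (le_trans (ler_normD _ _))// lerD.
Qed.

Lemma tameM f g : tame f -> tame g -> tame (fun x => f x * g x).
Proof.
move=> [df [B fB]] [dg [C gC]].
exists (fun x => f x *: dg x + g x *: df x), (B * C + C * B) => x.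
have [f1 f2 f3] := fB x; have [g1 g2 g3] := gC x.
split; first exact: is_deriveM.
  rewrite normrM ler_wpDr ?ler_pM//.
  by rewrite mulr_ge0// (le_trans _ f2, le_trans _ g2).
by rewrite (le_trans (ler_normD _ _))// lerD// normrM ler_pM.
Qed.

Lemma tameN f : tame f -> tame (fun x => - f x).
Proof.
move=> tf; have -> : (fun x => - f x) = (fun x => -1 * f x).
  by apply/funext => x; rewrite mulN1r.
exact: tameM (tame_cst _) tf.
Qed.

Lemma tame_sum (I : Type) (r : seq I) (F : I -> V -> R) :
  (forall i, tame (F i)) -> tame (fun x => \sum_(i <- r) F i x).
Proof.
move=> tF; elim: r => [|i r IH].
  rewrite (_ : (fun x => _) = fun=> 0); first exact: tame_cst.
  by apply/funext => x; rewrite big_nil.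
rewrite (_ : (fun x => _) = fun x => F i x + \sum_(j <- r) F j x).
  exact: tameD.
by apply/funext => x; rewrite big_cons.
Qed.

End Tame.

Lemma is_derive_comp (R : realType) (V : normedModType R) (u : V -> R)
    (h : R -> R) (x e : V) (du dh : R) :
  differentiable u x -> is_derive x e u du -> is_derive (u x) (1 : R) h dh ->
  is_derive x e (h \o u) (dh * du).
Proof.
move=> du' [_ <-] [/derivable1_diffP dh' <-].
apply: DeriveDef; first exact/diff_derivable/differentiable_comp.
rewrite !deriveE//; last exact: differentiable_comp.
(* The differential of [h] at [u x] is linear on the line, so its value at ['d u x e] is that number
   times its value at 1. *)
by rewrite diff_comp//= mulrC -['d u x e in LHS]mulr1 [LHS]linearZ.
Qed.

Lemma tame_comp_coord (R : realType) M (e : 'rV[R]_M) (k : 'I_M) (a c : R)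
    (h dh : R -> R) :
  (forall t, is_derive t (1 : R) h (dh t)) -> (forall t, `|h t| <= 1) ->
  (forall t, `|dh t| <= 1) ->
  tame e (fun x => h (a * (x 0 k + c))).
Proof.
move=> hd h1 dh1.
pose u (x : 'rV[R]_M) := a * (x 0 k + c).
(* The sum dominates both the bound 1 on [h] and the bound [|a * e 0 k|] on the derivative. *)
exists (fun x => dh (u x) * (a * e 0 k)), (1 + `|a * e 0 k|) => x.
split; last 2 first.
- by rewrite (le_trans (h1 _))// lerDl.
- by rewrite normrM ler_wpDl// ler_piMl.
have coord_lin : linear (fun y : 'rV[R]_M => y 0 k : R).
  by move=> b y z; rewrite !mxE.
pose L := GRing.isLinear.Build _ _ _ _ (fun y : 'rV[R]_M => y 0 k : R)
  coord_lin.
pose l : {linear 'rV[R]_M -> R} := HB.pack (fun y : 'rV[R]_M => y 0 k : R) L.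
have dl : is_diff x l l.
  apply: DiffDef; first exact/linear_differentiable/coord_continuous.
  by rewrite diff_lin //; exact: coord_continuous.
have du : is_diff x u (a *: (l : 'rV[R]_M -> R)).
  have -> : u = a *: ((l : 'rV[R]_M -> R) + cst c) by exact: funext.
  apply: is_diffZ; rewrite -[X in is_diff _ _ X]addr0.
  exact: is_diffD.
apply: is_derive_comp => //.
by apply: DeriveDef; [exact: diff_derivable|rewrite deriveE// diff_val].
Qed.

(** Both derivatives are limits of literally the same difference quotient [q]. *)
Lemma is_derive_line (R : realType) (V : normedModType R) (f : V -> R)
    (x e : V) (t df : R) :
  is_derive (t *: e + x) e f df ->
  is_derive t (1 : R) (fun s : R => f (s *: e + x)) df.
Proof.
pose q (h : R) := h^-1 *: (f (h *: e + (t *: e + x)) - f (t *: e + x)).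
have qE : (fun h : R => h^-1 *: (((fun s : R => f (s *: e + x)) \o shift t)
    (h *: 1) - f (t *: e + x))) = q.
  apply/funext => h; rewrite /q /= /shift /=.
  by rewrite [h *: 1]mulr1 scalerDl addrA.
move=> [fd fE]; apply: DeriveDef; first by rewrite /derivable qE.
by rewrite /derive qE.
Qed.

(** * From bounded partial derivatives to the Lipschitz bound *)

Section Lipschitz.
Variables (R : realType) (M : nat) (f : 'rV[R]_M -> R).
Hypothesis tame_f : forall j : 'I_M, tame (delta_mx 0 j) f.
Implicit Types (x y : 'rV[R]_M) (j : 'I_M).

(** Tameness supplies the upper bound that makes the supremum a genuine one. *)
Lemma partial_le_sup j x : cube x -> `|partial f j x| <= sup_partial f j.
Proof.
move=> cx; have [df [B fB]] := tame_f j.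
apply: ub_le_sup; last by exists x.
exists B => _ [y _ <-]; rewrite /partial.
by have [fd _ dB] := fB y; rewrite derive_val.
Qed.

Lemma coordinate_lipschitz j x (t : R) :
  cube x -> cube (t *: delta_mx 0 j + x) ->
  `|f (t *: delta_mx 0 j + x) - f x| <= sup_partial f j * `|t|.
Proof.
move=> cx cy; set e := delta_mx 0 j in cy *.
have [df [B fB]] := tame_f j.
pose g (s : R) := f (s *: e + x).
have dg s : is_derive s (1 : R) g (df (s *: e + x)).
  by apply: is_derive_line; have [] := fB (s *: e + x).
have cg a b : {within `[a, b], continuous g}.
  apply: derivable_within_continuous => s _; exact: ex_derive.
(* The edge stays in the cube: coordinate [j] lies between those of the two endpoints, and the
   others are those of [x]. The min and max cover both signs of [t]. *)
have bnd s : Num.min 0 t <= s <= Num.max 0 t ->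
    `|df (s *: e + x)| <= sup_partial f j.
  move=> st; have [fd _ _] := fB (s *: e + x).
  rewrite -(@derive_val _ _ _ _ _ _ _ fd); apply: partial_le_sup => k.
  move: (cx k) (cy k); rewrite !mxE eqxx/=.
  case: eqP => _; rewrite ?(mulr0, mulr1, add0r)//.
  by move: st; case: (leP 0 t) => t0 st c1 c2; lra.
have -> : f (t *: e + x) - f x = g t - g 0 by rewrite /g scale0r add0r.
have [t0|t0] := leP 0 t.
  have [s st ->] := MVT_segment t0 (fun s _ => dg s) (cg 0 t).
  rewrite subr0 normrM ler_wpM2r// bnd//.
  by rewrite (min_idPl t0) (max_idPr t0); move: st; rewrite in_itv.
have [s st gE] := MVT_segment (ltW t0) (fun s _ => dg s) (cg t 0).
rewrite distrC gE sub0r normrM normrN ler_wpM2r// bnd//.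
by rewrite (min_idPr (ltW t0)) (max_idPl (ltW t0)); move: st; rewrite in_itv.
Qed.

(** Cauchy-Schwarz against the all-ones vector, obtained by expanding a sum of squares of deviations
    from the mean, scaled by [M] to avoid division. *)
Lemma l1_le_l2norm x : (\sum_j `|x 0 j|) <= Num.sqrt M%:R * l2norm x.
Proof.
rewrite /l2norm -sqrtrM ?ler0n//.
set s := \sum_j _; set q := \sum_(j < M) _.
have s0 : 0 <= s by exact: sumr_ge0.
rewrite -(ger0_norm s0) -sqrtr_sqr ler_sqrt; last first.
  by rewrite mulr_ge0// sumr_ge0// => j _; rewrite sqr_ge0.
(* The expansion has a factor [M] to cancel, so the empty sum is treated apart. *)
have [M0|M0] := posnP M.
  rewrite /s big1 ?expr0n ?mulr_ge0 ?sumr_ge0// => j _;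
    by have := ltn_ord j; rewrite {2}M0.
have : 0 <= \sum_j (M%:R * `|x 0 j| - s) ^+ 2.
  by apply: sumr_ge0 => j _; rewrite sqr_ge0.
have -> : \sum_j (M%:R * `|x 0 j| - s) ^+ 2 = M%:R * (M%:R * q - s ^+ 2).
  transitivity (\sum_j
      (M%:R ^+ 2 * x 0 j ^+ 2 - 2 * M%:R * s * `|x 0 j| + s ^+ 2)).
    by apply: eq_bigr => j _; rewrite -[x 0 j ^+ 2]real_normK ?num_real//; ring.
  rewrite !big_split/= sumrN -!mulr_sumr sumr_const card_ord -/q -/s -mulr_natl.
  by ring.
by rewrite pmulr_rge0 ?ltr0n// subr_ge0.
Qed.

Lemma tame_lipschitz : l2_lipschitz_on (@cube R M) (lipschitz_bound f) f.
Proof.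
move=> x y cx cy; rewrite distrC.
pose S := \big[Num.max/0]_(j < M) sup_partial f j.
(* Corners of the path: the first [k] coordinates are already those of [y], so [z 0] is [x] and
   [z M] is [y]. *)
pose z (k : nat) : 'rV[R]_M := \row_j (if (j < k)%N then y 0 j else x 0 j).
have cz k : cube (z k) by move=> j; rewrite mxE; case: ifP.
have zE (j : 'I_M) : z j.+1 = (y 0 j - x 0 j) *: delta_mx 0 j + z j.
  apply/rowP => k; rewrite !mxE eqxx/= ltnS leq_eqVlt.
  have [->|kj] := eqVneq k j; first by rewrite eqxx ltnn mulr1 subrK.
  by rewrite -[(k == j :> nat)]/(k == j) (negPf kj) mulr0 add0r.
have -> : f y - f x = \sum_(j < M) (f (z j.+1) - f (z j)).
  rewrite -(big_mkord xpredT (fun k => f (z k.+1) - f (z k))) telescope_sumr//.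
  by congr (f _ - f _); apply/rowP => j; rewrite mxE ?ltn_ord.
have step (j : 'I_M) : `|f (z j.+1) - f (z j)| <= S * `|(x - y) 0 j|.
  rewrite zE; apply: le_trans (coordinate_lipschitz _ _) _ => //.
    by rewrite -zE.
  by rewrite !mxE distrC ler_wpM2r// le_bigmax.
apply: le_trans (ler_norm_sum _ _ _) _.
apply: le_trans (ler_sum _ (fun j _ => step j)) _.
rewrite -mulr_sumr /lipschitz_bound -/S mulrAC mulrC ler_wpM2r ?l1_le_l2norm//.
(* The maximum starts at 0, hence [S] is nonnegative. *)
exact: bigmax_ge_id.
Qed.

End Lipschitz.

(** * Entrywise limits and power series of diagonalized matrices *)

Lemma cvg_mx (T : topologicalType) m n (F : nat -> 'M[T]_(m, n))
    (L : 'M[T]_(m, n)) :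
  (forall i j, F k i j @[k --> \oo] --> L i j) -> F @ \oo --> L.
Proof.
move=> FL A [P LP PA].
(* There are finitely many entries, so the eventual conditions on them can be intersected. *)
have FP (ij : 'I_m * 'I_n) : \forall k \near \oo, P ij.1 ij.2 (F k ij.1 ij.2).
  exact: FL (LP _ _).
apply: filterS (filter_forall _ FP) => k Pk.
by apply: PA => i j; exact: (Pk (i, j)).
Qed.

Section ConjugatedDiagonal.
Variables (K : fieldType) (D : nat) (P : 'M[K]_D).
Hypothesis Pu : P \in unitmx.
Implicit Type d : 'rV[K]_D.

Lemma exp_conj_diag d k :
  (invmx P *m diag_mx d *m P) ^+ k =
  invmx P *m diag_mx (\row_j d 0 j ^+ k) *m P.
Proof.
elim: k => [|k IH].
  rewrite expr0 (_ : \row_j _ = const_mx 1) ?diag_const_mx ?mulmx1 ?mulVmx//.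
  by apply/rowP => j; rewrite !mxE.
rewrite exprS IH -[_ * _]/(_ *m _) !mulmxA mulmxK//.
rewrite -[invmx P *m _ *m diag_mx _]mulmxA mulmx_diag.
by congr (_ *m diag_mx _ *m _); apply/rowP => j; rewrite !mxE exprS.
Qed.

Lemma scale_conj_diag a d :
  a *: (invmx P *m diag_mx d *m P) = invmx P *m diag_mx (a *: d) *m P.
Proof. by rewrite scalemxAl scalemxAr [diag_mx (a *: d)]linearZ. Qed.

Lemma conj_diagE d i j :
  (invmx P *m diag_mx d *m P) i j = \sum_k invmx P i k * P k j * d 0 k.
Proof.
by rewrite mul_mx_diag mxE; apply: eq_bigr => k _; rewrite mxE mulrAC.
Qed.

(** Reduces a matrix power series to scalar series evaluated at the eigenvalues. *)
Lemma series_conj_diag (c : nat -> K) d n i j :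
  series (fun k => c k *: (invmx P *m diag_mx d *m P) ^+ k) n i j =
  \sum_k invmx P i k * P k j * series (fun l => c l * d 0 k ^+ l) n.
Proof.
rewrite /series/= summxE.
under [RHS]eq_bigr => k _ do rewrite mulr_sumr.
rewrite exchange_big; apply: eq_bigr => l _.
rewrite exp_conj_diag mxE conj_diagE mulr_sumr.
by apply: eq_bigr => k _; rewrite mxE mulrCA.
Qed.

End ConjugatedDiagonal.

(** * The scalar exponential and the exponential of a diagonalized matrix *)

Section CExp.
Variable R : realType.
Implicit Types (t : R).

Lemma cvg_real_complex (u : nat -> R) (a : R) :
  u @ \oo --> a -> (u n)%:C @[n --> \oo] --> (a%:C : R[i]).
Proof.
move=> /cvgrPdist_lt ua; apply/cvgrPdist_lt => e.
(* A positive element of [R[i]] has zero imaginary part and positive real part. *)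
rewrite ltcE => /andP[/eqP Im0 /= /ua]; apply: filterS => n ltn.
rewrite -rmorphB normc_def/= expr0n addr0 sqrtr_sqr ltcE/=.
by rewrite Im0 eqxx.
Qed.

(** This is exp(-it), with the sign of the gates rather than the usual one. *)
Definition cis t : R[i] := (cos t)%:C - 'i%C * (sin t)%:C.

(** Even powers of -i are real and odd ones imaginary, so by parity each term of the exponential
    series is a cosine term or a sine term. *)
Lemma cis_coeffE t k :
  (k`!%:R)^-1 * (- 'i%C * t%:C) ^+ k =
  (cos_coeff t k)%:C - 'i%C * (sin_coeff t k)%:C :> R[i].
Proof.
have iX : (- 'i%C) ^+ k = (-1) ^+ k./2 * (- 'i%C) ^+ odd k :> R[i].
  by rewrite -{1}[k]odd_double_half exprD -mul2n exprM sqrrN sqr_i mulrC.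
rewrite cos_coeffE sin_coeffE !rmorphM/= !fmorphV/= !rmorphXn/= !rmorph_nat.
rewrite !rmorphN1 exprMn iX.
case: (boolP (odd k)) => ko /=; last by rewrite expr0; ring.
have -> : k.-1./2 = k./2 by rewrite -{1}[k]odd_double_half ko add1n/= doubleK.
by rewrite expr1; ring.
Qed.

Lemma cvg_cis t :
  series (fun k => (k`!%:R)^-1 * (- 'i%C * t%:C) ^+ k) @ \oo --> cis t.
Proof.
have -> : series (fun k => (k`!%:R)^-1 * (- 'i%C * t%:C) ^+ k) =
    fun n => (series (cos_coeff t) n)%:C -
      'i%C * (series (sin_coeff t) n)%:C.
  apply/funext => n; rewrite /series/= (eq_bigr _ (fun k _ => cis_coeffE t k)).
  by rewrite big_split/= sumrN -mulr_sumr !rmorph_sum.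
have c := cvg_real_complex (@is_cvg_series_cos_coeff _ t).
have s := cvg_real_complex (@is_cvg_series_sin_coeff _ t).
have i : cst 'i%C @ \oo --> ('i%C : R[i]) by exact: cvg_cst.
rewrite /cis !unlock; exact: cvgB c (cvgM i s).
Qed.

Lemma expm_conj_diag D (P : 'M[R[i]]_D) (s : 'rV[R]_D) : P \in unitmx ->
  expm (invmx P *m diag_mx (\row_j (- 'i%C * (s 0 j)%:C)) *m P) =
  invmx P *m diag_mx (map_mx cis s) *m P.
Proof.
move=> Pu; apply: cvg_lim => //; apply: cvg_mx => i j.
rewrite conj_diagE.
under [X in X @ _ --> _]eq_fun => n do rewrite series_conj_diag//.
apply: cvg_big => [|k _]; first exact: add_continuous.
apply: cvgM; first exact: cvg_cst.
rewrite !mxE.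
exact: cvg_cis.
Qed.

(** * Tameness for complex and matrix values *)

Section TameComplex.
Variables (V : normedModType R) (e : V).
Implicit Types f g : V -> R[i].

(** Real and imaginary parts are kept apart so that only real derivatives occur; conjugation, needed
    for adjoints, is not complex differentiable. *)
Definition tameC f := tame e (fun x => complex.Re (f x)) /\
  tame e (fun x => complex.Im (f x)).

Lemma tameC_cst (a : R[i]) : tameC (fun=> a).
Proof. by split; exact: tame_cst. Qed.

Lemma tameCM f g : tameC f -> tameC g -> tameC (fun x => f x * g x).
Proof.
move=> [Rf If] [Rg Ig]; split.
  rewrite (_ : (fun x => _) =
      fun x => complex.Re (f x) * complex.Re (g x) +
        - (complex.Im (f x) * complex.Im (g x))).
    by apply: tameD; [|apply: tameN]; exact: tameM.
  by apply/funext => x; case: (f x) (g x) => [a b] [c d].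
rewrite (_ : (fun x => _) =
    fun x => complex.Re (f x) * complex.Im (g x) +
      complex.Im (f x) * complex.Re (g x)).
  by apply: tameD; exact: tameM.
by apply/funext => x; case: (f x) (g x) => [a b] [c d].
Qed.

Lemma tameC_sum (I : Type) (r : seq I) (F : I -> V -> R[i]) :
  (forall i, tameC (F i)) -> tameC (fun x => \sum_(i <- r) F i x).
Proof.
move=> tF; split.
  under eq_fun => x do rewrite raddf_sum.
  by apply: tame_sum => i; exact: (tF i).1.
under eq_fun => x do rewrite raddf_sum.
by apply: tame_sum => i; exact: (tF i).2.
Qed.

Lemma tameC_conj f : tameC f -> tameC (fun x => (f x)^*).
Proof.
move=> [Rf If]; split.
  by congr (tame e _): Rf; apply/funext => x; case: (f x).
by congr (tame e _): (tameN If); apply/funext => x; case: (f x).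
Qed.

Definition tame_mx m n (F : V -> 'M[R[i]]_(m, n)) :=
  forall i j, tameC (fun x => F x i j).

Lemma tame_mx_cst m n (A : 'M[R[i]]_(m, n)) : tame_mx (fun=> A).
Proof. by move=> i j; exact: tameC_cst. Qed.

Lemma tame_mulmx m n p (F : V -> 'M[R[i]]_(m, n)) (G : V -> 'M[R[i]]_(n, p)) :
  tame_mx F -> tame_mx G -> tame_mx (fun x => F x *m G x).
Proof.
move=> tF tG i j; under eq_fun => x do rewrite mxE.
by apply: tameC_sum => k; exact: tameCM.
Qed.

Lemma tame_mx_adjoint m n (F : V -> 'M[R[i]]_(m, n)) :
  tame_mx F -> tame_mx (fun x => (F x)^t*).
Proof.
move=> tF i j; under eq_fun => x do rewrite !mxE.
exact: tameC_conj.
Qed.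

End TameComplex.

(** * Tameness of gates, circuits and the cost *)

Section TameCircuit.
Variables (M D : nat) (H : 'I_M -> 'M[R[i]]_D) (c : 'I_M -> R) (e : 'rV[R]_M).
Hypothesis hH : forall j, H j \is hermsymmx.

Lemma tame_cis (k : 'I_M) (a b : R) :
  tameC e (fun x : 'rV[R]_M => cis (a * (x 0 k + b))).
Proof.
have cos1 t : `|cos t| <= 1 :> R by rewrite ler_norml cos_geN1 cos_le1.
have sin1 t : `|sin t| <= 1 :> R by rewrite ler_norml sin_geN1 sin_le1.
have Nsin1 t : `|- sin t| <= 1 :> R by rewrite normrN.
have := tame_comp_coord e k a b (@is_derive_cos R) cos1 Nsin1.
have := tame_comp_coord e k a b (@is_derive_sin R) sin1 cos1.
move=> ts tc; split.
  by congr (tame e _): tc; apply/funext => x; rewrite /cis/=; ring.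
by congr (tame e _): (tameN ts); apply/funext => x; rewrite /cis/=; ring.
Qed.

(** The diagonalizing matrix [P] does not depend on [x], so each entry is a fixed linear combination
    of values of [cis] at affine functions of [x 0 k]. *)
Lemma tame_expm (P : 'M[R[i]]_D) (s : 'rV[R]_D) (k : 'I_M) (b : R) :
  P \in unitmx ->
  tame_mx e (fun x : 'rV[R]_M => expm ((- 'i%C * (x 0 k + b)%:C) *:
    (invmx P *m diag_mx (map_mx (real_complex R) s) *m P))).
Proof.
move=> Pu.
pose t (x : 'rV[R]_M) := \row_j (s 0 j * (x 0 k + b)).
have tE (x : 'rV[R]_M) :
    (- 'i%C * (x 0 k + b)%:C) *: map_mx (real_complex R) s =
    \row_j (- 'i%C * (t x 0 j)%:C).
  apply/rowP => j; rewrite !mxE rmorphM/= [(s 0 j)%:C * _]mulrC.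
  exact/esym/mulrA.
have expmE (x : 'rV[R]_M) : expm ((- 'i%C * (x 0 k + b)%:C) *:
    (invmx P *m diag_mx (map_mx (real_complex R) s) *m P)) =
    invmx P *m diag_mx (map_mx cis (t x)) *m P.
  rewrite scale_conj_diag tE.
  exact: expm_conj_diag.
move=> i j; under eq_fun => x do rewrite expmE conj_diagE.
apply: tameC_sum => l; apply: tameCM; first exact: tameC_cst.
by under eq_fun => x do rewrite !mxE; exact: tame_cis.
Qed.

Lemma tame_param_gate (k : 'I_M) : tame_mx e (fun x : 'rV[R]_M =>
  expm ((- 'i%C * (x 0 k + c k)%:C) *: H k)).
Proof.
pose s := map_mx (@complex.Re R) (spectral_diag (H k)).
(* Eigenvalues of a Hermitian matrix are real, so taking real parts loses nothing. *)
have sE : spectral_diag (H k) = map_mx (real_complex R) s.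
  apply/rowP => j; rewrite !mxE; apply/esym/RRe_real.
  by have /mxOverP := hermitian_spectral_diag_real (hH k).
have /orthomx_spectralP HE := hermitian_normalmx (hH k).
have Pu := spectral_unit (H k).
(* [P] and [d] are abstracted first, so that replacing [H k] by its diagonalization does not rewrite
   inside them. *)
move: sE HE Pu; move: (spectralmx _) (spectral_diag _) => P d -> -> Pu.
exact: tame_expm.
Qed.

Lemma tame_circuit (gs : seq (gate R M D)) : tame_mx e (circuit_op H c gs).
Proof.
rewrite /circuit_op; elim: gs => [|g gs IH].
  by under eq_fun => x do rewrite big_nil; exact: tame_mx_cst.
have tg : tame_mx e (fun x => gate_op H c x g).
  by case: g => [A|k]; [exact: tame_mx_cst|exact: tame_param_gate].
under eq_fun => x do rewrite big_cons.
exact: tame_mulmx tg IH.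
Qed.

Lemma tame_cost gs O psi : tame e (cost H c gs O psi).
Proof.
have tU := tame_circuit gs.
have psiU := tame_mulmx (tame_mx_cst e (psi^t*)) (tame_mx_adjoint tU).
have psiUOU := tame_mulmx (tame_mulmx psiU (tame_mx_cst e O)) tU.
exact: (tame_mulmx psiUOU (tame_mx_cst e psi) 0 0).1.
Qed.

End TameCircuit.
End CExp.

Theorem theorem2 (R : realType) (M D : nat) (hM : (1 <= M)%N) (hD : (1 <= D)%N)
    (psi : 'cV[R[i]]_D) (hpsi : state_vector psi)
    (H : 'I_M -> 'M[R[i]]_D) (hH : forall j : 'I_M, H j \is hermsymmx)
    (c : 'I_M -> R)
    (gs : seq (gate R M D)) (hgs : is_circuit gs)
    (O : 'M[R[i]]_D) (hO : O \is hermsymmx) :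
  let f := cost H c gs O psi in
  l2_lipschitz_on (@cube R M) (lipschitz_bound f) f.
Proof. by apply: tame_lipschitz => j; exact: tame_cost. Qed.
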